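(* Fix $h>0$ and $T>0$, let $\kappa\ge\|f'\|_{C[-\beta,\beta]}$ and $\|u_{\rm init}\|_\infty\le\beta$, and assume that the exact solution $u_{h,e}$ of the space-discrete problem is smooth enough on $[0,T]$ (that is, of class $C^k$ on $[0,T]$ for some sufficiently large absolute integer $k$). Then there exist $\tau_0>0$ and a constant $C_{h,1}>0$ independent of $\tau$ (and of $n$) such that for all $0<\tau\le\tau_0$ the GSAV-EI1 iterates satisfy $$\|u^n-u_{h,e}(t_n)\|+|s^n-s_{h,e}(t_n)|\le C_{h,1}\,\tau,\qquad 0\le n\le\lfloor T/\tau\rfloor .$$
   Context: Spatial setting. Let $L>0$, $\Omega=(0,L)\times(0,L)$, $|\Omega|=L^2$, $M$ a positive integer, $h=L/M$. Let $\mathcal{M}_h$ be the finite-dimensional space of real grid functions $v=(v_{ij})_{i,j\in\mathbb{Z}}$ that are $M$-periodic in each index. For $v,w\in\mathcal{M}_h$ set $\langle v,w\rangle=h^2\sum_{i,j=1}^M v_{ij}w_{ij}$, $\|v\|=\sqrt{\langle v,v\rangle}$, $\|v\|_\infty=\max_{1\le i,j\le M}|v_{ij}|$. The discrete Laplacian is $\Delta_h v_{ij}=h^{-2}(v_{i+1,j}+v_{i-1,j}+v_{i,j+1}+v_{i,j-1}-4v_{ij})$. Scalar functions act on grid functions pointwise; functions of self-adjoint linear operators on $\mathcal{M}_h$ are understood as matrix functions; $I$ is the identity. Standing assumptions. $\varepsilon>0$; $f:\mathbb{R}\to\mathbb{R}$ is continuously differentiable and there is a constant $\beta>0$ (fixed)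 with $f(\beta)\le 0\le f(-\beta)$; $\|f'\|_{C[-\beta,\beta]}=\max_{[-\beta,\beta]}|f'|$; $F$ is a function with $F'=-f$; $u_{\rm init}\in\mathcal{M}_h$ is the (grid-projected) initial value; $\kappa>0$ is a stabilizing constant; $\sigma:\mathbb{R}\to\mathbb{R}$ is continuously differentiable with $\sigma>0$ and $\sigma'\ge0$ on $\mathbb{R}$. Notation. $E_{1h}(v)=\langle F(v),1\rangle$ and $g(v,r)=\sigma(r)/\sigma(E_{1h}(v))$ for $v\in\mathcal{M}_h$, $r\in\mathbb{R}$. Exact solution. $u_{h,e}:[0,\infty)\to\mathcal{M}_h$ is the solution of $\frac{d u_h}{dt}=\varepsilon^2\Delta_h u_h+f(u_h)$, $u_h(0)=u_{\rm init}$ (it satisfies $\|u_{h,e}(t)\|_\infty\le\beta$ for all $t$ when $\|u_{\rm init}\|_\infty\le\beta$), and $s_{h,e}(t)=E_{1h}(u_{h,e}(t))$. For a step $\tau>0$, $t_n=n\tau$. GSAV-EI1 scheme with step $\tau>0$. $u^0=u_{\rm init}$, $s^0=E_{1h}(u^0)$, and for $n\ge0$, with $L_\kappa^n=\kappa g(u^n,s^n)I-\varepsilon^2\Delta_h$, $N_\kappa^n(v,r)=g(v,r)f(v)+\kappa g(u^n,s^n)v$, and $\phi_1(a)=a^{-1}(e^a-1)$ for $a\ne0$, $$u^{n+1}=e^{-\tau L_\kappa^n}u^n+\tau\phi_1(-\tau L_\kappa^n)N_\kappa^n(u^n,s^n),\qquad s^{n+1}=s^n-g(u^n,s^n)\langle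 f(u^n),u^{n+1}-u^n\rangle.$$ *)

(* Defs.v *)
From HB Require Import structures.
From mathcomp Require Import all_boot all_order all_algebra.
From mathcomp Require Import all_classical all_reals all_analysis.
From mathcomp Require Import ring.
Import Order.TTheory GRing.Theory Num.Theory.
Import numFieldNormedType.Exports.

Set Implicit Arguments.
Unset Strict Implicit.
Unset Printing Implicit Defensive.

Local Open Scope classical_set_scope.
Local Open Scope ring_scope.

Section OneVariable.
Variable R : realType.

Definition C1 (f : R -> R) : Prop :=
  (forall x, derivable f x 1) /\ continuous (derive1 f).

Definition sup_abs (beta : R) (f : R -> R) : R :=
  sup [set `|f x| | x in `[- beta, beta]].

(* The value at 0 is the continuous extension; the operators L_kappa^n are
   positive definite, so it is never used by the scheme. *)
Definition phi1 (a : R) : R := if a == 0 then 1 else a^-1 * (expR a - 1).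

End OneVariable.

(* Derivatives relative to a subset D of the time axis: when D is an interval
   they are one-sided at the end points of D that belong to D, and two-sided
   at its interior points.  Values outside of D play no role. *)
Section Time.
Variables (R : realType) (m n : nat).
Implicit Types (D : set R) (u : R -> 'M[R]_(m, n)).

Definition deriv_on D u (t : R) (l : 'M[R]_(m, n)) : Prop :=
  (fun s => (s - t)^-1 *: (u s - u t)) @ within D (dnbhs t) --> l.

(* d j is the j-th derivative of u relative to D *)
Definition Ck_on D (k : nat) u : Prop :=
  exists d : nat -> R -> 'M[R]_(m, n),
    [/\ d 0%N = u,
        forall j t, (j < k)%N -> D t -> deriv_on D (d j) t (d j.+1 t) &
        forall j, (j <= k)%N -> {within D, continuous (d j)}].

End Time.

Section MatrixFunction.
Variables (R : realType) (n : nat).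
Implicit Types (A : 'M[R]_n) (f : R -> R).

Definition spectrum A : seq R :=
  finmap.enum_fset (fset_set [set a | eigenvalue A a]).

(* For a diagonalizable A (e.g. a symmetric one) this is the projection onto
   the eigenspace of a along the other eigenspaces. *)
Definition eigen_proj A (a : R) : 'M[R]_n :=
  \big[mulmx/1%:M]_(b <- spectrum A | b != a) ((a - b)^-1 *: (A - b%:M)).

(* Matrix function of a diagonalizable A by Sylvester's formula: if
   A = P^-1 diag(l_i) P then matfun f A = P^-1 diag(f l_i) P. *)
Definition matfun f A : 'M[R]_n :=
  \sum_(a <- spectrum A) f a *: eigen_proj A a.

Lemma mem_spectrum A a : (a \in spectrum A) = eigenvalue A a.
Proof.
have fin : finite_set [set x | eigenvalue A x].
  apply: contrapT => /(infinite_set_fset (size (char_poly A))) [B BA].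
  have p0 : char_poly A != 0 by rewrite monic_neq0 ?char_poly_monic.
  rewrite leqNgt => /negP; apply; apply: max_poly_roots p0 _ (finmap.fset_uniq B).
  by apply/allP => x /BA /=; rewrite eigenvalue_root_char.
by rewrite in_fset_set // mem_setE.
Qed.

Lemma eigen_matfun f A (a : R) (v : 'rV[R]_n) :
  v *m A = a *: v -> v *m matfun f A = f a *: v.
Proof.
move=> vA; have [->|v0] := eqVneq v 0; first by rewrite mul0mx scaler0.
have aA : a \in spectrum A by rewrite mem_spectrum; apply/eigenvalueP; exists v.
have vP (r : seq R) (c : R) (P : pred R) :
    v *m \big[mulmx/1%:M]_(b <- r | P b) ((c - b)^-1 *: (A - b%:M))
    = (\prod_(b <- r | P b) ((c - b)^-1 * (a - b))) *: v.
  elim: r => [|b r IH]; first by rewrite !big_nil mulmx1 scale1r.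
  rewrite !big_cons; case: (P b) => //.
  rewrite mulmxA -scalemxAr mulmxBr vA mul_mx_scalar -scalerBl scalerA.
  by rewrite -scalemxAl IH scalerA.
rewrite /matfun mulmx_sumr (big_rem a) //= big_seq big1 ?addr0.
  rewrite -scalemxAr vP big1 ?scale1r // => b ba.
  by rewrite mulVf // subr_eq0 eq_sym.
move=> c; rewrite mem_rem_uniq ?finmap.fset_uniq // inE => /andP[ca cA].
rewrite -scalemxAr vP (big_rem a) //= eq_sym ca subrr mulr0 mul0r scale0r.
by rewrite scaler0.
Qed.

End MatrixFunction.

(* An M-periodic grid function is given by its values on one period, indexed
   by 'I_M x 'I_M; ordS and ord_pred are the shifts i + 1 and i - 1 modulo M. *)
Section Grid.
Variables (R : realType) (M : nat) (h : R).
Implicit Types v w : 'M[R]_M.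

Definition inner v w : R := h ^+ 2 * \sum_(i < M) \sum_(j < M) v i j * w i j.

Definition norm2 v : R := Num.sqrt (inner v v).

Definition norm_oo v : R :=
  \big[Num.max/0]_(i < M) \big[Num.max/0]_(j < M) `|v i j|.

Definition lap v : 'M[R]_M :=
  \matrix_(i, j) (h ^- 2 * (v (ordS i) j + v (ord_pred i) j
                            + v i (ordS j) + v i (ord_pred j) - 4 * v i j)).

(* Linear operators on grid functions are M^2 x M^2 matrices acting on the
   right of the flattened grid function; the matrix of a linear map T is
   lin_mx T. *)
Definition op_app (A : 'M[R]_(M * M)) v : 'M[R]_M := vec_mx (mxvec v *m A).

Fact lap_is_linear : linear lap.
Proof. by move=> a v w; apply/matrixP => i j; rewrite !mxE; ring. Qed.

HB.instance Definition _ :=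
  GRing.isLinear.Build R 'M[R]_M 'M[R]_M *:%R lap lap_is_linear.

Lemma op_app_lap v : op_app (lin_mx lap) v = lap v.
Proof. by rewrite /op_app mul_rV_lin /= !mxvecK. Qed.

Definition exact_solution (eps : R) (f : R -> R) (uinit : 'M[R]_M)
    (u : R -> 'M[R]_M) : Prop :=
  u 0 = uinit /\
  forall t, 0 <= t ->
    deriv_on [set s | 0 <= s] u t (eps ^+ 2 *: lap (u t) + map_mx f (u t)).

Section Scheme.
Variables (f F sigma : R -> R) (eps kappa tau : R).

Definition E1 v : R := inner (map_mx F v) (const_mx 1).

Definition gfun v (r : R) : R := sigma r / sigma (E1 v).

Definition Lkappa (un : 'M[R]_M) (sn : R) : 'M[R]_(M * M) :=
  (kappa * gfun un sn)%:M - eps ^+ 2 *: lin_mx lap.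

Definition Nkappa (un : 'M[R]_M) (sn : R) v (r : R) : 'M[R]_M :=
  gfun v r *: map_mx f v + (kappa * gfun un sn) *: v.

Definition gsav_ei1_step (us : 'M[R]_M * R) : 'M[R]_M * R :=
  let: (un, sn) := us in
  let A := - tau *: Lkappa un sn in
  let un1 := op_app (matfun expR A) un
             + tau *: op_app (matfun (@phi1 R) A) (Nkappa un sn un sn) in
  (un1, sn - gfun un sn * inner (map_mx f un) (un1 - un)).

Definition gsav_ei1 (uinit : 'M[R]_M) (n : nat) : 'M[R]_M * R :=
  iter n gsav_ei1_step (uinit, E1 uinit).

End Scheme.
End Grid.

(* Main.v *)
(* Since h is fixed, the problem is an ordinary differential equation on the
   finite-dimensional space of pairs z = (u, s): both u_{h,e} and its modified
   energy s_{h,e} evolve by z' = W(z), where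
   W(u, s) = (G, - g <f(u), G>) and G = g f(u) + eps^2 Delta_h u, because g = 1
   along the exact solution.  The terms in kappa cancel in the scheme: from
   e^a = 1 + a phi_1(a) one gets u^{n+1} = u^n + tau phi_1(- tau L_kappa^n) G,
   and phi_1(a) = 1 + O(a), so that one step is z + tau W(z) + O(tau^2), locally
   uniformly in z.  As W is locally Lipschitz, a discrete Gronwall argument
   applies as long as the error is at most 1, which is guaranteed by taking
   tau_0 small; no maximum principle is needed. *)
Require Import Defs.
From HB Require Import structures.
From mathcomp Require Import all_boot all_order all_algebra.
From mathcomp Require Import all_classical all_reals all_analysis.
From mathcomp Require Import ring lra.
From mathcomp.real_closed Require Import complex.
Import Order.TTheory GRing.Theory Num.Theory.
Import numFieldNormedType.Exports.
Local Open Scope classical_set_scope.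
Local Open Scope ring_scope.

Set Implicit Arguments.
Unset Strict Implicit.

(** * Matrix functions and the discrete Laplacian *)

(** The Hermitian spectral theorem over [R[i]] supplies the eigenbasis, which is then brought back
    to real entries. The rows of [P] are left eigenvectors, in keeping with operators that act on
    the right. *)
Lemma symmetric_diagonalizable (R : rcfType) n (A : 'M[R]_n) :
  A^T = A ->
  exists (P : 'M[R]_n) (d : 'rV[R]_n), P \in unitmx /\ P *m A = diag_mx d *m P.
Proof.
move=> Asym; pose C := R[i]%C; pose rc : {rmorphism R -> C} := real_complex R.
pose Ac := map_mx rc A.
have rcR x : rc x \is Num.real by rewrite /= complex_real.
have Ac_real : Ac \is a mxOver Num.real by apply/mxOverP => i j; rewrite mxE.
have Ac_herm : Ac \is hermsymmx.
  apply: realsym_hermsym => //; apply/is_hermitianmxP.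
  by rewrite expr0 scale1r map_mx_id // map_trmx Asym.
have Ac_eq := orthomx_spectralP (hermitian_normalmx Ac_herm).
have d_real := hermitian_spectral_diag_real Ac_herm.
set Q := spectralmx Ac in Ac_eq; set d := spectral_diag Ac in Ac_eq d_real.
have Qu : Q \in unitmx by exact: spectral_unit.
(* Over R[i] the matrix is similar to a real diagonal one, hence so it is over R. *)
have [|||P] := @real_similar C n Ac (diag_mx d).
- exists Q => //; apply/(simmxP Qu).
  by rewrite {1}Ac_eq !mulmxA mulmxV // mul1mx.
- exact: Ac_real.
- apply/mxOverP => i j; rewrite mxE; case: eqP => _; last exact: real0.
  by rewrite mulr1n (mxOverP _ _).
rewrite inE /= => /andP[P_real Pu] /(simmxP Pu) PA.
have Re_rc (m k : nat) (B : 'M[C]_(m, k)) : B \is a mxOver Num.real ->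
    B = map_mx rc (map_mx (@complex.Re R) B).
  move=> /mxOverP BR; apply/matrixP => i j; rewrite !mxE /=.
  by have /complex_realP[x ->] := BR i j.
move: PA Pu; rewrite (Re_rc _ _ P) // (Re_rc _ _ d) //.
set P' := map_mx _ P; set d' := map_mx _ d => PA Pu.
exists P', d'; split; first by rewrite map_unitmx in Pu.
move: PA; rewrite -map_diag_mx -!map_mxM => /matrixP PA; apply/matrixP => i j.
by have := PA i j; rewrite [LHS]mxE [RHS]mxE => /fmorph_inj.
Qed.

Section Matrices.
Context {R : realType}.

(** Each row of [P] is a left eigenvector of [A], so [eigen_matfun] applies row by row; repeated
    eigenvalues cause no trouble. *)
Lemma matfun_diag n (A P : 'M[R]_n) (d : 'rV[R]_n) (f : R -> R) :
  P \in unitmx -> P *m A = diag_mx d *m P ->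
  P *m matfun f A = diag_mx (map_mx f d) *m P.
Proof.
move=> Pu PA; apply/row_matrixP => i; rewrite !row_mul.
have rowd (e : 'rV[R]_n) : row i (diag_mx e) *m P = e 0 i *: row i P.
  by rewrite row_diag_mx -scalemxAl -rowE.
rewrite rowd mxE; apply: eigen_matfun.
by rewrite -row_mul PA row_mul rowd.
Qed.

(** The shifts [ordS] and [ord_pred] are inverse to each other, so transposition exchanges them, and
    the stencil contains both in each direction. *)
Lemma lap_symmetric (M : nat) (h : R) :
  (lin_mx (@lap R M h))^T = lin_mx (@lap R M h).
Proof.
apply/matrixP => k l; rewrite mxE.
case/mxvec_indexP: k => i j; case/mxvec_indexP: l => i' j'.
have entry (a b a' b' : 'I_M) : lin_mx (@lap R M h) (mxvec_index a b) (mxvec_index a' b')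
    = lap h (delta_mx a b) a' b'.
  rewrite -(mxvecE (lap h _)) -mul_vec_lin mxvec_delta -rowE.
  by rewrite [RHS]mxE.
rewrite !entry !mxE.
have e1 (a b : 'I_M) : (ordS a == b) = (ord_pred b == a).
  by rewrite (can2_eq (@ordSK M) (@ord_predK M)) eq_sym.
have e2 (a b : 'I_M) : (ord_pred a == b) = (ordS b == a).
  by rewrite e1.
rewrite !(e1, eq_sym i', eq_sym j').
ring.
Qed.

Lemma mx_norm_le m n (A : 'M[R]_(m, n)) (c : R) :
  0 <= c -> (forall i j, `|A i j| <= c) -> `|A| <= c.
Proof.
by move=> c0 Ac; rewrite [leLHS]/Num.Def.normr /= mx_normrE; apply: bigmax_le => // -[i j] _; exact: Ac.
Qed.

Lemma le_mx_norm m n (A : 'M[R]_(m, n)) i j : `|A i j| <= `|A|.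
Proof.
by rewrite [leRHS]/Num.Def.normr /= mx_normrE; apply/bigmax_geP; right => /=; exists (i, j).
Qed.

(** The norm of a matrix is here its largest entry in absolute value, which is not
    submultiplicative: the inner dimension enters as a factor. *)
Lemma ler_norm_mulmx m n p (A : 'M[R]_(m, n)) (B : 'M[R]_(n, p)) :
  `|A *m B| <= n%:R * `|A| * `|B|.
Proof.
apply: mx_norm_le => [|i j]; first by rewrite !mulr_ge0.
rewrite mxE (le_trans (ler_norm_sum _ _ _)) //.
apply: (@le_trans _ _ (\sum_(k < n) `|A| * `|B|)).
  by apply: ler_sum => k _; rewrite normrM ler_pM ?le_mx_norm.
by rewrite sumr_const card_ord -[leLHS]mulr_natl mulrA.
Qed.

Lemma ler_norm_op_app M (A : 'M[R]_(M * M)) (v : 'M[R]_M) :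
  `|op_app A v| <= (M * M)%:R * `|A| * `|v|.
Proof.
have vecn (w : 'rV[R]_(M * M)) : `|vec_mx w| <= `|w|.
  by apply: mx_norm_le => // i j; rewrite mxE le_mx_norm.
have mxvn (w : 'M[R]_M) : `|mxvec w| <= `|w|.
  by apply: mx_norm_le => // i k; case/mxvec_indexP: k => a b;
     rewrite ord1 mxvecE le_mx_norm.
rewrite (le_trans (vecn _)) // (le_trans (ler_norm_mulmx _ _)) //.
by rewrite mulrAC ler_wpM2l ?mulr_ge0 // mxvn.
Qed.


(** On each eigenvalue this is e^a = 1 + a phi_1(a), where the second term vanishes at a = 0. *)
Lemma matfun_expR_phi1 n (A P : 'M[R]_n) (d : 'rV[R]_n) :
  P \in unitmx -> P *m A = diag_mx d *m P ->
  matfun expR A = 1%:M + A *m matfun (@phi1 R) A.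
Proof.
move=> Pu PA; apply: (can_inj (mulKmx Pu)).
rewrite mulmxDr mulmx1 mulmxA PA -mulmxA !(matfun_diag _ Pu PA).
rewrite mulmxA -{2}[P]mul1mx -mulmxDl; congr (_ *m P).
apply/matrixP => i j; rewrite mul_diag_mx !mxE; case: eqP => [->|_]; last first.
  by rewrite !mulr0n mulr0 addr0.
rewrite !mulr1n /phi1; have [->|a0] := eqVneq (d 0 j) 0.
  by rewrite expR0 mul0r addr0.
by rewrite mulrA divff // mul1r addrC subrK.
Qed.

End Matrices.

(** * Locally Lipschitz functions *)

Section LocallyLipschitz.
Context {R : realType}.
Implicit Types f g : R -> R.

(** On the line this agrees, by compactness, with being Lipschitz near each point; a constant for
    each bound [B] is the form suited to composition with bounded maps. *)
Definition locally_lipschitz f := forall B : R, exists2 K : R, 0 <= K &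
  forall x y, `|x| <= B -> `|y| <= B -> `|f x - f y| <= K * `|x - y|.

(** Mean value theorem, with the maximum of |df| over the compact interval [-B, B] as constant. *)
Lemma is_derive_locally_lipschitz f df :
  (forall x, is_derive x (1 : R) f (df x)) -> continuous df -> locally_lipschitz f.
Proof.
move=> fd cdf B.
(* For negative [B] no point qualifies, and the interval below would be empty. *)
have [B0|B0] := ltP B 0.
  by exists 0 => // x y xB; have := le_lt_trans xB B0; rewrite normr_lt0.
have cf : continuous f.
  by move=> x; apply: differentiable_continuous; apply/derivable1_diffP; exact: ex_derive.
have NBB : - B <= B by lra.
have [|c cB cmax] := @EVT_max R (fun x => `|df x|) (- B) B NBB.
  apply: continuous_subspaceT => x.
  by apply: continuous_comp; [exact: cdf | exact: norm_continuous].
exists `|df c| => //.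
suff le x y : `|x| <= B -> `|y| <= B -> x <= y -> `|f y - f x| <= `|df c| * `|y - x|.
  move=> x y xB yB; have [xy|/ltW yx] := leP x y; last exact: le.
  by rewrite distrC (distrC x) le.
move=> xB yB xy.
have [e exy ->] := MVT_segment xy (fun z _ => fd z) (continuous_subspaceT cf).
rewrite normrM ler_wpM2r // cmax //.
move: exy xB yB; rewrite !in_itv /= !ler_norml => /andP[? ?] /andP[? ?] /andP[? ?].
by apply/andP; split; lra.
Qed.

Lemma C1_is_derive f : C1 f -> forall x, is_derive x (1 : R) f (derive1 f x).
Proof. by move=> [fd _] x; rewrite derive1E; apply: derivableP; exact: fd. Qed.

Lemma C1_locally_lipschitz f : C1 f -> locally_lipschitz f.
Proof.
by move=> fC1; apply: is_derive_locally_lipschitz (C1_is_derive fC1) fC1.2.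
Qed.

Lemma expR_locally_lipschitz : locally_lipschitz (@expR R).
Proof.
by apply: is_derive_locally_lipschitz (@is_derive_expR R) _; exact: continuous_expR.
Qed.

Lemma C1_inv_locally_lipschitz f : C1 f -> (forall x, f x != 0) ->
  locally_lipschitz (fun x => (f x)^-1).
Proof.
move=> fC1 f0.
have cf : continuous f.
  by move=> x; apply: differentiable_continuous; apply/derivable1_diffP; exact: fC1.1.
apply: (@is_derive_locally_lipschitz _
  (fun x => - ((f x)^-1 * (f x)^-1) * derive1 f x)).
  move=> x; have fd := C1_is_derive fC1 x.
  apply: is_derive_eq (is_deriveV (f0 x) fd) _.
  by rewrite -invfM -expr2.
move=> x; have cV : (fun y => (f y)^-1) @ x --> (f x)^-1.
  exact: cvgV (f0 x) (cf x).
exact: cvgM (cvgN (cvgM cV cV)) (fC1.2 x).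
Qed.

(** By the mean value theorem phi_1(a) = e^c for some c between 0 and a, so phi_1(a) - 1 = e^c - e^0
    is controlled by a Lipschitz constant of the exponential on [-B, B]. *)
Lemma phi1B1_le (B : R) : exists2 K : R, 0 <= K &
  forall a, `|a| <= B -> `|phi1 a - 1| <= K * `|a|.
Proof.
have [K K0 expK] := expR_locally_lipschitz B.
exists K => // a aB; rewrite /phi1; have [->|a0] := eqVneq a 0.
  by rewrite subrr !normr0 mulr0.
suff [c ca ->] : exists2 c, `|c| <= `|a| & a^-1 * (expR a - 1) = expR c.
  rewrite -expR0 (le_trans (expK _ _ (le_trans ca aB) _)) ?normr0 //.
    exact: le_trans aB.
  by rewrite subr0 ler_wpM2l.
have cE (A : set R) : {within A, continuous (@expR R)}.
  by apply: continuous_subspaceT; exact: continuous_expR.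
have [ap|an] := ltP 0 a.
  have [c] := MVT_segment (ltW ap) (fun z _ => is_derive_expR z) (cE _).
  rewrite in_itv /= expR0 => /andP[c0 ca] ->; exists c.
    by rewrite !ger0_norm // ltW.
  by rewrite subr0 mulrC mulfK.
have [c] := MVT_segment an (fun z _ => is_derive_expR z) (cE _).
rewrite in_itv /= expR0 => /andP[ac c0] E; exists c.
  by rewrite !ler0_norm // lerN2.
by rewrite -opprB E sub0r !mulrN opprK mulrC mulfK.
Qed.

End LocallyLipschitz.

(** * Calculus of bounded Lipschitz maps *)

Section BoundedLipschitz.
Context {R : realType} {V : normedZmodType R} (D : set V).

(** Boundedness is bundled with the Lipschitz property because stability under products and
    compositions requires both. *)
Definition bounded_lipschitz (W : normedZmodType R) (f : V -> W) :=
  exists K : R, [/\ 0 <= K, forall x, D x -> `|f x| <= K &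
    forall x y, D x -> D y -> `|f x - f y| <= K * `|x - y|].

Lemma bounded_lipschitz_cst (W : normedZmodType R) (c : W) :
  bounded_lipschitz (fun=> c).
Proof.
by exists `|c|; split=> // x y _ _; rewrite subrr normr0 mulr_ge0.
Qed.

Lemma bounded_lipschitzD (W : normedZmodType R) (f g : V -> W) :
  bounded_lipschitz f -> bounded_lipschitz g ->
  bounded_lipschitz (fun x => f x + g x).
Proof.
move=> [K [K0 fK fL]] [J [J0 gJ gL]]; exists (K + J); split.
- exact: addr_ge0.
- by move=> x Dx; rewrite (le_trans (ler_normD _ _)) ?lerD ?fK ?gJ.
- move=> x y Dx Dy; rewrite opprD addrACA (le_trans (ler_normD _ _)) //.
  by rewrite mulrDl; apply: lerD; [exact: fL | exact: gL].
Qed.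

Lemma bounded_lipschitzN (W : normedZmodType R) (f : V -> W) :
  bounded_lipschitz f -> bounded_lipschitz (fun x => - f x).
Proof.
move=> [K [K0 fK fL]]; exists K; split=> // [x Dx|x y Dx Dy].
  by rewrite normrN fK.
by rewrite -opprD normrN fL.
Qed.

Lemma bounded_lipschitzM (f g : V -> R) :
  bounded_lipschitz f -> bounded_lipschitz g ->
  bounded_lipschitz (fun x => f x * g x).
Proof.
(* One [K * J] for each term of f(x) (g(x) - g(y)) + (f(x) - f(y)) g(y). *)
move=> [K [K0 fK fL]] [J [J0 gJ gL]]; exists (K * J + K * J); split.
- by rewrite addr_ge0 ?mulr_ge0.
- move=> x Dx; rewrite normrM (@le_trans _ _ (K * J)) ?ler_pM ?fK ?gJ //.
  by rewrite lerDl mulr_ge0.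
- move=> x y Dx Dy.
  have -> : f x * g x - f y * g y = f x * (g x - g y) + (f x - f y) * g y by ring.
  rewrite (le_trans (ler_normD _ _)) // [leRHS]mulrDl !normrM lerD //.
    by rewrite -mulrA ler_pM ?fK ?gL.
  by rewrite mulrAC ler_pM ?fL ?gJ.
Qed.

Lemma bounded_lipschitz_sum (W : normedZmodType R) n (f : 'I_n -> V -> W) :
  (forall i, bounded_lipschitz (f i)) ->
  bounded_lipschitz (fun x => \sum_(i < n) f i x).
Proof.
elim: n f => [|n IH] f fL.
  under eq_fun do rewrite big_ord0; exact: bounded_lipschitz_cst.
under eq_fun do rewrite big_ord_recr /=.
by apply: bounded_lipschitzD => //; exact: IH.
Qed.

Lemma bounded_lipschitz_comp (g : R -> R) (f : V -> R) :
  locally_lipschitz g -> bounded_lipschitz f ->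
  bounded_lipschitz (fun x => g (f x)).
Proof.
move=> gL [K [K0 fK fL]]; have [J J0 gJ] := gL K.
(* [J] is a Lipschitz constant of [g] on [-K, K]; the value of [g] at 0 is added to bound g(f(x))
   through its distance to g(0). *)
exists (J * K + `|g 0|); split; first by rewrite addr_ge0 ?mulr_ge0.
- move=> x Dx; rewrite -{1}[g (f x)](subrK (g 0)) (le_trans (ler_normD _ _)) //.
  rewrite lerD2r (le_trans (gJ _ _ (fK _ Dx) _)) ?normr0 // subr0.
  by rewrite ler_wpM2l ?fK.
- move=> x y Dx Dy; rewrite (le_trans (gJ _ _ (fK _ Dx) (fK _ Dy))) //.
  rewrite (@le_trans _ _ (J * (K * `|x - y|))) ?ler_wpM2l ?fL //.
  by rewrite mulrA ler_wpM2r // lerDl.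
Qed.

Lemma bounded_lipschitz_mx m n (f : V -> 'M[R]_(m, n)) :
  (forall i j, bounded_lipschitz (fun x => f x i j)) -> bounded_lipschitz f.
Proof.
move=> fL.
have [K KP] : exists K : 'I_m -> 'I_n -> R, forall i j,
    [/\ 0 <= K i j, forall x, D x -> `|f x i j| <= K i j &
    forall x y, D x -> D y -> `|f x i j - f y i j| <= K i j * `|x - y|].
  have [K KP] := choice (fun ij : 'I_m * 'I_n => fL ij.1 ij.2).
  by exists (fun i j => K (i, j)) => i j; exact: KP (i, j).
(* The sum of the entrywise constants dominates each of them, hence serves for the maximum norm. *)
have K0 : 0 <= \sum_i \sum_j K i j.
  by apply: sumr_ge0 => i _; apply: sumr_ge0 => j _; have [] := KP i j.
have leK i j : K i j <= \sum_i \sum_j K i j.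
  rewrite (bigD1 i) //= (bigD1 j) //= -addrA lerDl addr_ge0 //.
    by apply: sumr_ge0 => j' _; have [] := KP i j'.
  by apply: sumr_ge0 => i' _; apply: sumr_ge0 => j' _; have [] := KP i' j'.
exists (\sum_i \sum_j K i j); split=> // [x Dx|x y Dx Dy].
  apply: mx_norm_le => // i j; apply: le_trans (leK i j).
  by have [_ + _] := KP i j; apply.
apply: mx_norm_le => [|i j]; first by rewrite mulr_ge0.
rewrite !mxE; apply: (@le_trans _ _ (K i j * `|x - y|)).
  by have [_ _] := KP i j; apply.
by rewrite ler_wpM2r.
Qed.

Lemma bounded_lipschitz_pair (W W' : normedZmodType R) (f : V -> W) (g : V -> W') :
  bounded_lipschitz f -> bounded_lipschitz g ->
  bounded_lipschitz (fun x => (f x, g x) : (W * W')%type).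
Proof.
move=> [K [K0 fK fL]] [J [J0 gJ gL]]; exists (Num.max K J); split.
- by rewrite le_max K0.
- by move=> x Dx; rewrite prod_normE /= ge_max !le_max fK ?gJ //= orbT.
- move=> x y Dx Dy; rewrite prod_normE /= ge_max.
  rewrite (le_trans (fL _ _ Dx Dy)) ?(le_trans (gL _ _ Dx Dy)) //=.
    by rewrite ler_wpM2r // le_max lexx orbT.
  by rewrite ler_wpM2r // le_max lexx.
Qed.

End BoundedLipschitz.

(** * Consistency of the scheme *)

Section Scheme.
Context {R : realType} {M : nat}.
Variables (h : R) (f F sigma : R -> R) (eps kappa : R).
Implicit Types (z : 'M[R]_M * R) (tau B : R).

(* The vector field W of the limit equation z' = W(z), z = (u, s): flow_u is
   its grid-function component G. *)
Definition flow_u z : 'M[R]_M :=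
  gfun h F sigma z.1 z.2 *: map_mx f z.1 + eps ^+ 2 *: lap h z.1.

Definition flow z : 'M[R]_M * R :=
  (flow_u z, - gfun h F sigma z.1 z.2 * inner h (map_mx f z.1) (flow_u z)).

Lemma ler_norm_inner (v w : 'M[R]_M) :
  `|inner h v w| <= h ^+ 2 * (M * M)%:R * `|v| * `|w|.
Proof.
rewrite /inner normrM ger0_norm ?sqr_ge0 // -2![leRHS]mulrA.
apply: ler_wpM2l; rewrite ?sqr_ge0 //.
rewrite (le_trans (ler_norm_sum _ _ _)) //.
apply: (@le_trans _ _ (\sum_(i < M) \sum_(j < M) `|v| * `|w|)).
  apply: ler_sum => i _; rewrite (le_trans (ler_norm_sum _ _ _)) //.
  by apply: ler_sum => j _; rewrite normrM ler_pM ?le_mx_norm.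
by rewrite !sumr_const !card_ord -mulrnA mulr_natl.
Qed.

Lemma innerBr (v w w' : 'M[R]_M) : inner h v (w - w') = inner h v w - inner h v w'.
Proof.
rewrite /inner -mulrBr -sumrB; congr (_ * _); apply: eq_bigr => i _.
by rewrite -sumrB; apply: eq_bigr => j _; rewrite !mxE mulrBr.
Qed.

Lemma innerZr (v w : 'M[R]_M) (c : R) : inner h v (c *: w) = c * inner h v w.
Proof.
rewrite /inner mulrCA; congr (_ * _); rewrite mulr_sumr; apply: eq_bigr => i _.
by rewrite mulr_sumr; apply: eq_bigr => j _; rewrite !mxE mulrCA.
Qed.

Lemma op_appDl (A A' : 'M[R]_(M * M)) (v : 'M[R]_M) :
  op_app (A + A') v = op_app A v + op_app A' v.
Proof. by rewrite /op_app mulmxDr linearD. Qed.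

Lemma op_app1 (v : 'M[R]_M) : op_app 1%:M v = v.
Proof. by rewrite /op_app mulmx1 mxvecK. Qed.

Lemma op_appMl (A A' : 'M[R]_(M * M)) (v : 'M[R]_M) :
  op_app (A *m A') v = op_app A' (op_app A v).
Proof. by rewrite /op_app vec_mxK mulmxA. Qed.

Lemma op_appDr (A : 'M[R]_(M * M)) (v w : 'M[R]_M) :
  op_app A (v + w) = op_app A v + op_app A w.
Proof. by rewrite /op_app linearD mulmxDl linearD. Qed.

Lemma op_appZr (A : 'M[R]_(M * M)) (c : R) (v : 'M[R]_M) :
  op_app A (c *: v) = c *: op_app A v.
Proof. by rewrite /op_app linearZ -scalemxAl linearZ. Qed.

Lemma op_app_Lkappa tau (u : 'M[R]_M) (s : R) (v : 'M[R]_M) :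
  op_app (- tau *: Lkappa h F sigma eps kappa u s) v =
  - tau *: ((kappa * gfun h F sigma u s) *: v - eps ^+ 2 *: lap h v).
Proof.
rewrite -(op_app_lap h v) /op_app /Lkappa -scalemxAr linearZ /=; congr (_ *: _).
by rewrite mulmxBr linearB /= mul_mx_scalar linearZ /= mxvecK -scalemxAr linearZ.
Qed.

(** Beyond [z.1], both terms of the update are images under phi_1(A), acting together on A u + tau
    N; there the two terms in [kappa] cancel and tau times [flow_u z] remains. *)
Lemma step_u tau z (P : 'M[R]_(M * M)) (d : 'rV[R]_(M * M)) :
  let A := - tau *: Lkappa h F sigma eps kappa z.1 z.2 in
  P \in unitmx -> P *m A = diag_mx d *m P ->
  (gsav_ei1_step h f F sigma eps kappa tau z).1 =
  z.1 + tau *: op_app (matfun (@phi1 R) A) (flow_u z).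
Proof.
case: z => u s A Pu PA; rewrite /gsav_ei1_step /=.
rewrite -/A (matfun_expR_phi1 Pu PA) op_appDl op_app1 op_appMl -addrA; congr (_ + _).
rewrite -!op_appZr -op_appDr; congr (op_app _ _).
rewrite op_app_Lkappa /flow_u /Nkappa /=.
by apply/matrixP => i j; rewrite !mxE; ring.
Qed.

Hypothesis f_lip : locally_lipschitz f.
Hypothesis F_lip : locally_lipschitz F.
Hypothesis sigma_lip : locally_lipschitz sigma.
Hypothesis sigmaV_lip : locally_lipschitz (fun x => (sigma x)^-1).

(** * Uniform bounds on a ball of the phase space *)

Section Ball.
Variable B : R.
Hypothesis B0 : 0 <= B.
Let D := [set z : 'M[R]_M * R | `|z| <= B].

Lemma bounded_lipschitz_entry i j : bounded_lipschitz D (fun z => z.1 i j).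
Proof.
have le z : `|z.1 i j| <= `|z|.
  by rewrite (le_trans (le_mx_norm _ _ _)) // prod_normE le_max lexx.
(* [B] bounds the values, and 1 is a Lipschitz constant of a coordinate. *)
exists (Num.max B 1); split; first by rewrite le_max B0.
- by move=> z Dz; rewrite le_max (le_trans (le z)).
- move=> z z' Dz Dz'; have := le (z - z'); rewrite !mxE => /le_trans; apply.
  by rewrite -[leLHS]mul1r ler_wpM2r // le_max lexx orbT.
Qed.

Lemma bounded_lipschitz_snd : bounded_lipschitz D (fun z => z.2).
Proof.
have le z : `|z.2| <= `|z| by rewrite prod_normE le_max lexx orbT.
exists (Num.max B 1); split; first by rewrite le_max B0.
- by move=> z Dz; rewrite le_max (le_trans (le z)).
- move=> z z' Dz Dz'; rewrite (le_trans (le (z - z'))) //.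
  by rewrite -[leLHS]mul1r ler_wpM2r // le_max lexx orbT.
Qed.

Lemma bounded_lipschitz_map_mx (g : R -> R) : locally_lipschitz g ->
  bounded_lipschitz D (fun z => map_mx g z.1).
Proof.
move=> gL; apply: bounded_lipschitz_mx => i j; under eq_fun do rewrite mxE.
exact: bounded_lipschitz_comp gL (bounded_lipschitz_entry i j).
Qed.

Lemma bounded_lipschitz_inner (v w : 'M[R]_M * R -> 'M[R]_M) :
  (forall i j, bounded_lipschitz D (fun z => v z i j)) ->
  (forall i j, bounded_lipschitz D (fun z => w z i j)) ->
  bounded_lipschitz D (fun z => inner h (v z) (w z)).
Proof.
move=> vL wL; apply: bounded_lipschitzM; first exact: bounded_lipschitz_cst.
apply: bounded_lipschitz_sum => i; apply: bounded_lipschitz_sum => j.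
exact: bounded_lipschitzM.
Qed.

Lemma bounded_lipschitz_E1 : bounded_lipschitz D (fun z => E1 h F z.1).
Proof.
apply: bounded_lipschitz_inner => i j; under eq_fun do rewrite mxE.
  exact: bounded_lipschitz_comp F_lip (bounded_lipschitz_entry i j).
exact: bounded_lipschitz_cst.
Qed.

Lemma bounded_lipschitz_gfun :
  bounded_lipschitz D (fun z => gfun h F sigma z.1 z.2).
Proof.
apply: bounded_lipschitzM.
  exact: bounded_lipschitz_comp sigma_lip bounded_lipschitz_snd.
exact: (bounded_lipschitz_comp sigmaV_lip bounded_lipschitz_E1).
Qed.

Lemma bounded_lipschitz_flow_u_entry i j :
  bounded_lipschitz D (fun z => flow_u z i j).
Proof.
under eq_fun do rewrite !mxE.
have cst := bounded_lipschitz_cst; have entry := bounded_lipschitz_entry.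
apply: bounded_lipschitzD.
  apply: bounded_lipschitzM; first exact: bounded_lipschitz_gfun.
  exact: bounded_lipschitz_comp f_lip (entry i j).
do 2 (apply: bounded_lipschitzM; first exact: cst).
apply: bounded_lipschitzD; last first.
  by apply: bounded_lipschitzN; apply: bounded_lipschitzM.
by do 3 apply: bounded_lipschitzD => //.
Qed.

Lemma bounded_lipschitz_flow : bounded_lipschitz D flow.
Proof.
apply: bounded_lipschitz_pair.
  by apply: bounded_lipschitz_mx => i j; exact: bounded_lipschitz_flow_u_entry.
apply: bounded_lipschitzM; first exact: bounded_lipschitzN bounded_lipschitz_gfun.
apply: bounded_lipschitz_inner => i j; last exact: bounded_lipschitz_flow_u_entry.
under eq_fun do rewrite mxE.
exact: bounded_lipschitz_comp f_lip (bounded_lipschitz_entry i j).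
Qed.

(** [Lkappa] is a scalar matrix minus a multiple of the Laplacian, so one eigenbasis [P] of the
    Laplacian serves for all [z] and [tau]. The eigenvalues of [A] are O(tau) uniformly on the ball,
    and so are the values of phi_1 - 1 on them; conjugation by [P] costs a fixed factor. *)
Lemma matfun_phi1B1_le : exists2 K : R, 0 <= K &
  forall tau z, 0 <= tau <= 1 -> D z ->
  exists (P : 'M[R]_(M * M)) d, let A := - tau *: Lkappa h F sigma eps kappa z.1 z.2 in
   [/\ P \in unitmx, P *m A = diag_mx d *m P &
       `|matfun (@phi1 R) A - 1%:M| <= K * tau].
Proof.
have [P [d [Pu Pd]]] := symmetric_diagonalizable (@lap_symmetric R M h).
have [G [G0 gG _]] := bounded_lipschitz_gfun.
(* [Ka * tau] bounds every eigenvalue of [A]; since tau <= 1, all of them lie in [-Ka, Ka], where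
   [phi1B1_le] is applied. *)
pose Ka := `|kappa| * G + eps ^+ 2 * `|d|.
have Ka0 : 0 <= Ka by apply: addr_ge0; apply: mulr_ge0; rewrite ?sqr_ge0.
have [K K0 phiK] := phi1B1_le Ka.
pose n : R := (M * M)%:R.
exists (n * (n * `|invmx P| * (K * Ka)) * `|P|); first by rewrite !mulr_ge0.
move=> tau z /andP[tau0 tau1] Dz.
pose a := - tau *: (const_mx (kappa * gfun h F sigma z.1 z.2) - eps ^+ 2 *: d).
exists P, a => A.
have PA : P *m A = diag_mx a *m P.
  rewrite /A /a /Lkappa -scalemxAr [diag_mx _]linearZ /= -scalemxAl; congr (_ *: _).
  rewrite mulmxBr [diag_mx _]linearB /= mulmxBl diag_const_mx scalar_mxC; congr (_ - _).
  by rewrite -scalemxAr [diag_mx _]linearZ /= -scalemxAl Pd.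
split=> //.
have -> : matfun (@phi1 R) A - 1%:M =
    invmx P *m diag_mx (map_mx (fun x => phi1 x - 1) a) *m P.
  apply: (can_inj (mulKmx Pu)); rewrite mulmxBr mulmx1 (matfun_diag _ Pu PA).
  rewrite !mulmxA mulmxV // mul1mx -[in X in _ - X](mul1mx P) -mulmxBl; congr (_ *m _).
  by apply/matrixP => i j; rewrite !mxE; case: eqP => _; rewrite ?mulr1n // !mulr0n subr0.
rewrite (le_trans (ler_norm_mulmx _ _)) // [leRHS]mulrAC ler_wpM2r //.
rewrite -[leRHS]mulrA ler_wpM2l // (le_trans (ler_norm_mulmx _ _)) //.
rewrite -[leRHS]mulrA ler_wpM2l ?mulr_ge0 //.
apply: mx_norm_le => [|i j]; first by rewrite !mulr_ge0.
rewrite mxE mxE; case: eqP => _; last by rewrite mulr0n normr0 !mulr_ge0.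
rewrite mulr1n.
have aKa : `|a 0 i| <= Ka * tau.
  rewrite !mxE normrM normrN (ger0_norm tau0) mulrC ler_wpM2r //.
  rewrite (le_trans (ler_normB _ _)) //; apply: lerD.
    by rewrite normrM ler_wpM2l ?gG.
  rewrite normrM [`|eps ^+ 2|]ger0_norm ?sqr_ge0 //.
  by apply: ler_wpM2l; rewrite ?sqr_ge0 // le_mx_norm.
rewrite (le_trans (phiK _ _)) //; first by rewrite (le_trans aKa) // ler_piMr.
by rewrite -mulrA ler_wpM2l.
Qed.

(** The defect [r] in the first component is tau (phi_1(A) - 1) applied to [flow_u z], hence
    O(tau^2). The second component is affine in the increment of the first, so its defect is -g
    <f(u), r>. *)
Lemma step_consistent : exists2 K : R, 0 <= K &
  forall tau z, 0 <= tau <= 1 -> D z ->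
  `|gsav_ei1_step h f F sigma eps kappa tau z - (z + tau *: flow z)| <= K * tau ^+ 2.
Proof.
have [K K0 phiK] := matfun_phi1B1_le.
have [G [G0 gG _]] := bounded_lipschitz_gfun.
have [J [J0 uJ _]] := bounded_lipschitz_flow.
have [H [H0 fH _]] := bounded_lipschitz_map_mx f_lip.
pose C := (M * M)%:R * K * J.
have C0 : 0 <= C by rewrite !mulr_ge0.
(* [G] bounds g and [H] bounds f(u) on the ball; the rest comes from [ler_norm_inner] applied to
   f(u) and [r]. *)
pose C' := G * (h ^+ 2 * (M * M)%:R * H * C).
have n0 : 0 <= h ^+ 2 * (M * M)%:R by apply: mulr_ge0; rewrite ?sqr_ge0.
have C'0 : 0 <= C' by do 3 apply: mulr_ge0 => //.
exists (Num.max C C'); first by rewrite le_max C0.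
move=> tau z tau01 Dz; have /andP[tau0 _] := tau01.
have [P [d [Pu PA phi_le]]] := phiK _ _ tau01 Dz.
set step := gsav_ei1_step _ _ _ _ _ _ _.
have step1 : step z = ((step z).1,
    z.2 - gfun h F sigma z.1 z.2 * inner h (map_mx f z.1) ((step z).1 - z.1)).
  by case: (z).
set r := (step z).1 - z.1 - tau *: flow_u z.
have rE : r = tau *: op_app (matfun (@phi1 R)
    (- tau *: Lkappa h F sigma eps kappa z.1 z.2) - 1%:M) (flow_u z).
  rewrite op_appDl scalerDr /r /step (step_u Pu PA) (addrC z.1) addrK.
  by congr (_ + _); rewrite -scalerN -{1}[flow_u z]op_app1 /op_app !mulmxN !linearN.
have r_le : `|r| <= C * tau ^+ 2.
  rewrite rE normrZ ger0_norm // expr2 mulrCA ler_wpM2l //.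
  rewrite (le_trans (ler_norm_op_app _ _)) // /C.
  have uz : `|flow_u z| <= J.
    by apply: le_trans (uJ _ Dz); rewrite prod_normE le_max lexx.
  rewrite [leRHS]mulrAC ler_pM ?mulr_ge0 //.
  by rewrite -[leRHS]mulrA ler_wpM2l.
have -> : step z - (z + tau *: flow z) =
    (r, - gfun h F sigma z.1 z.2 * inner h (map_mx f z.1) r).
  rewrite [LHS]surjective_pairing step1; congr pair => /=.
    by rewrite /r opprD addrA.
  rewrite /r [in RHS]innerBr innerZr; set g := gfun _ _ _ _ _.
  set i1 := inner _ _ _; set i2 := inner _ _ _; rewrite /GRing.scale /=. ring.
rewrite prod_normE /= ge_max; apply/andP; split.
  by rewrite (le_trans r_le) // ler_wpM2r ?sqr_ge0 // le_max lexx.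
apply: (@le_trans _ _ (C' * tau ^+ 2)); last first.
  by rewrite ler_wpM2r ?sqr_ge0 // le_max lexx orbT.
rewrite normrM normrN /C' -[leRHS]mulrA; apply: ler_pM => //; first exact: gG.
rewrite (le_trans (ler_norm_inner _ _)) // -[leRHS]mulrA; apply: ler_pM => //.
  exact: mulr_ge0.
by apply: ler_wpM2l => //; exact: fH.
Qed.

End Ball.
End Scheme.

(** * The exact solution *)

Section ExactSolution.
Context {R : realType}.

(** At t > 0 the half-line is a neighbourhood of t, so the relative derivative is two-sided. *)
Lemma deriv_on_is_derive m n (u : R -> 'M[R]_(m, n)) t l i j : 0 < t ->
  deriv_on [set s | 0 <= s] u t l ->
  is_derive t (1 : R) (fun s => u s i j) (l i j).
Proof.
move=> t0 ul.
suff cvgl : (fun e : R => e^-1 *: (((fun s => u s i j) \o shift t) (e *: 1) - u t i j))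
    @ 0^' --> l i j.
  by apply: DeriveDef; [apply: cvgP; exact: cvgl | exact: cvg_lim cvgl].
apply/cvgrPdist_lt => e e0.
move/cvgrPdist_lt: ul => /(_ e e0); rewrite !near_withinE.
move=> /nbhs_ballP[d /= d0 ud]; apply/nbhs_ballP.
(* A radius at most [t] keeps the shifted time [x + t] nonnegative. *)
exists (Num.min d t) => /=; first by rewrite lt_min d0.
move=> x; rewrite -ball_normE /ball_ /= sub0r normrN lt_min => /andP[xd xt] x0.
have := ud (x + t); rewrite -ball_normE /ball_ /= opprD addrCA subrr addr0 normrN => /(_ xd).
rewrite -subr_eq0 addrK => /(_ x0); rewrite ltr_norml in xt.
have xt0 : 0 <= x + t by case/andP: xt; lra.
move=> /(_ xt0); apply: le_lt_trans.
apply: le_trans (le_mx_norm _ i j).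
by rewrite !mxE /= [x *: 1]mulr1.
Qed.

(** * Mean value estimates on a time interval *)

Variable T : R.

(** The derivative is asked for only inside the interval, where that of the exact solution is
    two-sided; continuity takes care of the end points. *)
Lemma derive_bounded_lipschitz (x y : R -> R) (K : R) :
  (forall t, 0 < t < T -> is_derive t (1 : R) x (y t)) ->
  {within `[0, T], continuous x} ->
  (forall t, 0 <= t <= T -> `|y t| <= K) ->
  forall s t, 0 <= s <= T -> 0 <= t <= T -> `|x s - x t| <= K * `|s - t|.
Proof.
move=> xy cx yK.
suff le s t : 0 <= s -> s <= t -> t <= T -> `|x t - x s| <= K * `|t - s|.
  move=> s t /andP[s0 sT] /andP[t0 tT].
  by have [st|/ltW ts] := leP s t; [rewrite distrC (distrC s)|]; exact: le.
move=> s0 st tT.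
have xd c : c \in `]s, t[ -> is_derive c (1 : R) x (y c).
  by rewrite in_itv /= => /andP[? ?]; apply: xy; apply/andP; split; lra.
have cst : {within `[s, t], continuous x}.
  apply: continuous_subspaceW cx => c /=; rewrite !in_itv /= => /andP[? ?].
  by apply/andP; split; lra.
have [c] := MVT_segment st xd cst; rewrite in_itv /= => /andP[sc ct] ->.
by rewrite normrM ler_wpM2r // yK //; apply/andP; split; lra.
Qed.

(** The increment equals tau y(c) with c within tau of t, and Lipschitz continuity of y takes the
    place of a bound on a second derivative. *)
Lemma derive_lipschitz_taylor (x y : R -> R) (K : R) : 0 <= K ->
  (forall t, 0 < t < T -> is_derive t (1 : R) x (y t)) ->
  {within `[0, T], continuous x} ->
  (forall s t, 0 <= s <= T -> 0 <= t <= T -> `|y s - y t| <= K * `|s - t|) ->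
  forall t tau, 0 <= t -> 0 <= tau -> t + tau <= T ->
  `|x (t + tau) - x t - tau * y t| <= K * tau ^+ 2.
Proof.
move=> K0 xy cx yK t tau t0 tau0 tT.
have ttau : t <= t + tau by lra.
have xd c : c \in `]t, t + tau[ -> is_derive c (1 : R) x (y c).
  by rewrite in_itv /= => /andP[? ?]; apply: xy; apply/andP; split; lra.
have cst : {within `[t, t + tau], continuous x}.
  apply: continuous_subspaceW cx => c /=; rewrite !in_itv /= => /andP[? ?].
  by apply/andP; split; lra.
have [c] := MVT_segment ttau xd cst; rewrite in_itv /= => /andP[tc ct] ->.
rewrite addrAC subrr add0r [_ * tau]mulrC -mulrBr normrM ger0_norm //.
rewrite expr2 mulrCA ler_wpM2l // (le_trans (yK _ _ _ _)) //; try (apply/andP; split; lra).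
by rewrite ler_wpM2l // ger0_norm; lra.
Qed.

Lemma is_derive_sum_fun n (g : 'I_n -> R -> R) (dg : 'I_n -> R) t :
  (forall i, is_derive t (1 : R) (g i) (dg i)) ->
  is_derive t (1 : R) (fun s => \sum_(i < n) g i s) (\sum_(i < n) dg i).
Proof.
move=> gd; have -> : (fun s => \sum_(i < n) g i s) = \sum_(i < n) g i.
  by apply/funext => s; rewrite fct_sumE.
exact: is_derive_sum.
Qed.

(** * The exact solution as an orbit of the flow *)

Context {M : nat}.
Variables (h : R) (f F sigma : R -> R) (eps : R).
Hypothesis f_lip : locally_lipschitz f.
Hypothesis F_derive : forall x : R, is_derive x (1 : R) F (- f x).
Hypothesis F_lip : locally_lipschitz F.
Hypothesis sigma_lip : locally_lipschitz sigma.
Hypothesis sigma_neq0 : forall x, sigma x != 0.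
Hypothesis sigmaV_lip : locally_lipschitz (fun x => (sigma x)^-1).

Variable u : R -> 'M[R]_M.
Hypothesis T0 : 0 < T.
Hypothesis u_cont : {within `[0, T], continuous u}.
Hypothesis u_derive : forall t, 0 <= t ->
  deriv_on [set s | 0 <= s] u t (eps ^+ 2 *: lap h (u t) + map_mx f (u t)).

Let z t : 'M[R]_M * R := (u t, E1 h F (u t)).

(** The second component of [z t] is [E1] of the first, so the factor [gfun] is sigma(s) / sigma(s)
    = 1. *)
Lemma flow_u_exact t :
  flow_u h f F sigma eps (z t) = eps ^+ 2 *: lap h (u t) + map_mx f (u t).
Proof. by rewrite /flow_u /gfun divff // scale1r addrC. Qed.

Lemma is_derive_entry i j t : 0 < t < T ->
  is_derive t (1 : R) (fun s => u s i j) (flow_u h f F sigma eps (z t) i j).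
Proof.
move=> /andP[t0 _]; rewrite flow_u_exact.
by apply: deriv_on_is_derive => //; exact: u_derive (ltW t0).
Qed.

Lemma E1E (v : 'M[R]_M) :
  E1 h F v = h ^+ 2 * \sum_(i < M) \sum_(j < M) F (v i j).
Proof.
rewrite /E1 /inner; congr (_ * _); apply: eq_bigr => i _; apply: eq_bigr => j _.
by rewrite !mxE mulr1.
Qed.

(** By the chain rule and F' = -f, the energy has derivative -<f(u), u'>, which is the second
    component of the flow because g = 1 on the orbit. *)
Lemma is_derive_E1 t : 0 < t < T ->
  is_derive t (1 : R) (fun s => E1 h F (u s)) (flow h f F sigma eps (z t)).2.
Proof.
move=> tT.
have -> : (fun s => E1 h F (u s)) =
    h ^+ 2 \*: (fun s => \sum_(i < M) \sum_(j < M) F (u s i j)).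
  by apply/funext => s; rewrite E1E.
rewrite /= {1}/gfun divff // mulN1r /inner -mulrN.
apply: is_deriveZ; rewrite -sumrN; apply: is_derive_sum_fun => i.
rewrite -sumrN; apply: is_derive_sum_fun => j; rewrite mxE -mulNr.
exact: (is_derive1_comp (F_derive _) (is_derive_entry i j tT)).
Qed.

Lemma entry_cont i j : {within `[0, T], continuous (fun s => u s i j)}.
Proof.
move=> t; apply: (@continuous_comp (subspace `[0, T]) _ _ u (fun A : 'M[R]_M => A i j)).
  exact: u_cont.
exact: coord_continuous.
Qed.

Lemma E1_cont : {within `[0, T], continuous (fun s => E1 h F (u s))}.
Proof.
move=> t; apply: (@continuous_comp (subspace `[0, T]) _ _ u (E1 h F)); first exact: u_cont.
have -> : E1 h F = fun v : 'M[R]_M => h ^+ 2 * \sum_(i < M) \sum_(j < M) F (v i j).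
  by apply/funext => v; rewrite E1E.
move: (u t) => v; apply: (@continuous_comp _ _ _
  (fun w : 'M[R]_M => \sum_(i < M) \sum_(j < M) F (w i j)) ( *%R (h ^+ 2))); last first.
  exact: mulrl_continuous.
apply: continuous_big => [|i _]; first exact: add_continuous.
apply: continuous_big => [|j _ w]; first exact: add_continuous.
apply: (@continuous_comp _ _ _ (fun A : 'M[R]_M => A i j) F).
  exact: coord_continuous.
apply: differentiable_continuous; apply/derivable1_diffP.
by have Fd := F_derive (w i j); exact: ex_derive.
Qed.

(** The bound on [u] comes from compactness of [0, T], and the one on the energy from boundedness of
    [E1] on the ball thus obtained. *)
Lemma exact_bounded : exists2 B, 0 <= B & forall t, 0 <= t <= T -> `|z t| <= B.
Proof.
have [|c _ cmax] := @EVT_max R (fun t => `|u t|) 0 T (ltW T0).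
  move=> t; apply: (@continuous_comp (subspace `[0, T]) _ _ u (fun A : 'M[R]_M => `|A|)).
    exact: u_cont.
  exact: norm_continuous.
have [K [K0 EK _]] := bounded_lipschitz_E1 (M := M) h F_lip (normr_ge0 (u c)).
exists (Num.max `|u c| K); first by rewrite le_max K0 orbT.
move=> t tT; have uc : `|u t| <= `|u c| by apply: cmax; rewrite in_itv.
rewrite prod_normE /= ge_max !le_max uc /=; apply/orP; right.
(* [E1] reads only the first component, so the second is filled with 0. *)
by apply: (EK (u t, 0)); rewrite /= prod_normE /= normr0 ge_max uc /=.
Qed.

(** The flow is bounded by [K] along the orbit, so [z] is [K]-Lipschitz in time; the flow being
    [K]-Lipschitz in space, its value along the orbit is [K * K]-Lipschitz in time, and the Taylor
    estimate applies to each component. *)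
Lemma exact_consistent : exists2 K : R, 0 <= K &
  forall t tau, 0 <= t -> 0 <= tau -> t + tau <= T ->
  `|z (t + tau) - (z t + tau *: flow h f F sigma eps (z t))| <= K * tau ^+ 2.
Proof.
have [B B0 zB] := exact_bounded.
have [K [K0 flowK flowL]] :=
  bounded_lipschitz_flow (M := M) h eps f_lip F_lip sigma_lip sigmaV_lip B0.
have entry_le (w : 'M[R]_M * R) i j : `|w.1 i j| <= `|w|.
  by rewrite (le_trans (le_mx_norm _ _ _)) // prod_normE le_max lexx.
have snd_le (w : 'M[R]_M * R) : `|w.2| <= `|w|.
  by rewrite prod_normE le_max lexx orbT.
have zL s t : 0 <= s <= T -> 0 <= t <= T -> `|z s - z t| <= K * `|s - t|.
  move=> sT tT; rewrite prod_normE /= ge_max; apply/andP; split.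
    apply: mx_norm_le => [|i j]; first by rewrite mulr_ge0.
    have yK r : 0 <= r <= T -> `|flow_u h f F sigma eps (z r) i j| <= K.
      by move=> rT; exact: le_trans (entry_le _ i j) (flowK _ (zB _ rT)).
    have := derive_bounded_lipschitz (is_derive_entry i j) (@entry_cont i j) yK sT tT.
    by rewrite !mxE.
  have yK r : 0 <= r <= T -> `|(flow h f F sigma eps (z r)).2| <= K.
    by move=> rT; exact: le_trans (snd_le _) (flowK _ (zB _ rT)).
  exact: (derive_bounded_lipschitz is_derive_E1 E1_cont yK sT tT).
have fL s t : 0 <= s <= T -> 0 <= t <= T ->
    `|flow h f F sigma eps (z s) - flow h f F sigma eps (z t)| <= K * K * `|s - t|.
  move=> sT tT; rewrite (le_trans (flowL _ _ (zB _ sT) (zB _ tT))) //.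
  by rewrite -[leRHS]mulrA ler_wpM2l // zL.
have KK0 : 0 <= K * K by exact: mulr_ge0.
exists (K * K) => // t tau t0 tau0 tT.
rewrite prod_normE /= ge_max; apply/andP; split.
  apply: mx_norm_le => [|i j]; first by apply: mulr_ge0; rewrite ?sqr_ge0.
  have yL s r : 0 <= s <= T -> 0 <= r <= T ->
      `|flow_u h f F sigma eps (z s) i j - flow_u h f F sigma eps (z r) i j|
      <= K * K * `|s - r|.
    move=> sT rT; apply: le_trans (fL _ _ sT rT).
    apply: le_trans (entry_le _ i j) => /=.
    by move: (flow_u _ _ _ _ _ _) (flow_u _ _ _ _ _ _) => a b; rewrite !mxE.
  have := derive_lipschitz_taylor KK0 (is_derive_entry i j) (@entry_cont i j) yL t0 tau0 tT.
  by move: (flow_u _ _ _ _ _ _) => a; rewrite /= !mxE opprD addrA.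
rewrite opprD addrA.
have yL s r : 0 <= s <= T -> 0 <= r <= T ->
    `|(flow h f F sigma eps (z s)).2 - (flow h f F sigma eps (z r)).2|
    <= K * K * `|s - r|.
  by move=> sT rT; exact: le_trans (snd_le _) (fL _ _ sT rT).
exact: (derive_lipschitz_taylor KK0 is_derive_E1 E1_cont yL t0 tau0 tT).
Qed.

End ExactSolution.

(** * Convergence *)

(** The bounds on [W] and [step] hold on a ball of radius one more than that of the orbit. The
    induction that bounds the error also keeps the iterates in this ball. *)
Lemma one_step_convergence (R : realType) (V : normedModType R)
    (step : R -> V -> V) (W : V -> V) (z : R -> V) (T B L K K' : R) :
  0 <= L -> 0 <= K -> 0 <= K' -> 0 <= T ->
  (forall t, 0 <= t <= T -> `|z t| <= B) ->
  (forall x y, `|x| <= B + 1 -> `|y| <= B + 1 -> `|W x - W y| <= L * `|x - y|) ->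
  (forall tau x, 0 <= tau <= 1 -> `|x| <= B + 1 ->
    `|step tau x - (x + tau *: W x)| <= K * tau ^+ 2) ->
  (forall t tau, 0 <= t -> 0 <= tau -> t + tau <= T ->
    `|z (t + tau) - (z t + tau *: W (z t))| <= K' * tau ^+ 2) ->
  exists tau0 C : R, [/\ 0 < tau0, 0 < C &
    forall tau, 0 < tau -> tau <= tau0 -> forall n : nat, n%:R * tau <= T ->
    `|iter n (step tau) (z 0) - z (n%:R * tau)| <= C * tau].
Proof.
move=> L0 K0 K'0 T0 zB WL stepK zK; pose J := L + K + K'.
have J0 : 0 <= J by rewrite !addr_ge0.
(* The product of the two witnesses is 1, so an error of at most C tau is at most 1 when tau <=
   tau0; moreover tau0 <= 1, as [stepK] demands. *)
exists (expR (- (J * T))), (expR (J * T)); split; rewrite ?expR_gt0 // => tau tau0 tauT.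
have tau1 : tau <= 1.
  by rewrite (le_trans tauT) // -[leRHS]expR0 ler_expR oppr_le0 mulr_ge0.
have growth n : n%:R * tau <= T -> (1 + J * tau) ^+ n <= expR (J * T).
  move=> nT; apply: (@le_trans _ _ (expR (J * tau) ^+ n)).
    rewrite lerXn2r ?nnegrE ?expR_ge0 ?expR_ge1Dx //.
    by rewrite addr_ge0 ?mulr_ge0 // ltW.
  by rewrite -expRM_natl ler_expR mulrCA ler_wpM2l.
(* The closed form solves e_{n+1} = (1 + J tau) e_n + J tau^2, e_0 = 0. *)
suff err n : n%:R * tau <= T ->
    `|iter n (step tau) (z 0) - z (n%:R * tau)| <= tau * ((1 + J * tau) ^+ n - 1).
  move=> n nT; rewrite (le_trans (err n nT)) // mulrC ler_wpM2r ?(ltW tau0) //.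
  by rewrite lerBlDr (le_trans (growth n nT)) // lerDl.
elim: n => [|n IH] nT; first by rewrite mul0r subrr normr0 expr0 subrr mulr0.
have ntT : n%:R * tau + tau <= T by rewrite -[X in _ + X]mul1r -mulrDl natr1.
have nT' : n%:R * tau <= T by lra.
have nt0 : 0 <= n%:R * tau by rewrite mulr_ge0 // ltW.
have zn : `|z (n%:R * tau)| <= B by apply: zB; rewrite nt0.
move: (IH nT'); rewrite iterS; set x := iter _ _ _; set y := z _ => xy.
(* Bootstrap: the error bound at step n places [x] in the ball where the next step is controlled. *)
have xy1 : `|x - y| <= 1.
  apply: (@le_trans _ _ (expR (- (J * T)) * expR (J * T))); last first.
    by rewrite -expRD addNr expR0.
  rewrite (le_trans xy) //; apply: ler_pM => //; first exact: ltW.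
    by rewrite subr_ge0 exprn_ege1 // lerDl mulr_ge0 // ltW.
  by rewrite lerBlDr (le_trans (growth n nT')) // lerDl.
have xB : `|x| <= B + 1.
  by rewrite -(subrK y x) addrC (le_trans (ler_normD _ _)) // lerD.
have yB : `|y| <= B + 1 by rewrite (le_trans zn) // lerDl.
have -> : n.+1%:R * tau = n%:R * tau + tau by rewrite -natr1 mulrDl mul1r.
(* The new error splits into the defect of the scheme, the defect of the exact orbit and the
   difference of two explicit Euler steps. *)
have -> : step tau x - z (n%:R * tau + tau) =
    (step tau x - (x + tau *: W x)) - (z (n%:R * tau + tau) - (y + tau *: W y))
    + ((x - y) + tau *: (W x - W y)).
  have -> : x - y + tau *: (W x - W y) = (x + tau *: W x) - (y + tau *: W y).
    by rewrite scalerBr opprD addrACA.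
  by rewrite opprB addrAC !subrKA.
have e1 := stepK tau x; have e2 := zK (n%:R * tau) tau nt0 (ltW tau0) ntT.
have e3 := WL x y xB yB.
rewrite (le_trans (ler_normD _ _)) // (le_trans (lerD (ler_normB _ _) (ler_normD _ _))) //.
rewrite normrZ (gtr0_norm tau0).
rewrite (ltW tau0) tau1 in e1; have {}e1 := e1 isT xB.
move: e1 e2 e3 xy; rewrite -/y [_ ^+ n.+1]exprS /J; set a := `|step _ _ - _|; set b := `|_ - (y + _)|.
set c := `|W x - W y|; set d := `|x - y|; set p := _ ^+ n => e1 e2 e3 xy.
have d0 : 0 <= d by exact: normr_ge0.
have ctau : tau * c <= tau * (L * d) by rewrite ler_wpM2l // ltW.
have Jd : tau * (L + K + K') * d <= tau * (L + K + K') * (tau * (p - 1)).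
  by rewrite ler_wpM2l // mulr_ge0 // ltW.
have KKd : 0 <= tau * (K + K') * d by rewrite !mulr_ge0 ?addr_ge0 // ltW.
have Ltau : 0 <= L * tau ^+ 2 by rewrite mulr_ge0 ?sqr_ge0.
(* The three parts give (1 + L tau) d + (K + K') tau^2; replacing both rates by [J] only adds
   nonnegative terms. *)
have -> : tau * ((1 + (L + K + K') * tau) * p - 1) =
  tau * (p - 1) + tau * (L + K + K') * (tau * (p - 1)) + L * tau ^+ 2 + K * tau ^+ 2 + K' * tau ^+ 2 by ring.
have E : tau * (L + K + K') * d = tau * (L * d) + tau * (K + K') * d by ring.
lra.
Qed.

(** The sum has M^2 terms, each at most the square of the maximum norm. *)
Lemma norm2_le (R : realType) (M : nat) (h : R) (v : 'M[R]_M) :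
  norm2 h v <= `|h| * M%:R * `|v|.
Proof.
have c0 : 0 <= `|h| * M%:R * `|v| by rewrite !mulr_ge0.
rewrite -[leRHS]ger0_norm // -sqrtr_sqr ler_wsqrtr // (le_trans (ler_norm _)) //.
rewrite (le_trans (ler_norm_inner _ _ _)) // !exprMn real_normK ?num_real //.
by rewrite natrM -!expr2 -mulrA -expr2.
Qed.

Theorem theorem3p7 :
  exists k : nat,
  forall (R : realType) (L : R) (M : nat) (eps beta kappa T : R)
         (f F sigma : R -> R) (uinit : 'M[R]_M) (ue : R -> 'M[R]_M),
  let h := L / M%:R in
  0 < L -> (0 < M)%N -> 0 < eps -> 0 < beta -> 0 < kappa -> 0 < T ->
  C1 f -> f beta <= 0 <= f (- beta) ->
  (forall x : R, is_derive x (1 : R) F (- f x)) ->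
  C1 sigma -> (forall x, 0 < sigma x) -> (forall x, 0 <= derive1 sigma x) ->
  sup_abs beta (derive1 f) <= kappa ->
  norm_oo uinit <= beta ->
  exact_solution h eps f uinit ue ->
  Ck_on `[0, T] k ue ->
  exists tau0 C : R, [/\ 0 < tau0, 0 < C &
    forall tau, 0 < tau -> tau <= tau0 ->
    forall n : nat, n%:Z <= Num.floor (T / tau) ->
      let un := (gsav_ei1 h f F sigma eps kappa tau uinit n).1 in
      let sn := (gsav_ei1 h f F sigma eps kappa tau uinit n).2 in
      let tn := n%:R * tau in
      norm2 h (un - ue tn) + `|sn - E1 h F (ue tn)| <= C * tau].
Proof.
(* Regularity index 0 gives continuity on [0, T]; the differential equation and the Lipschitz flow
   supply the Taylor estimate. *)
exists 0%N => R L M eps beta kappa T f F sigma uinit ue h _ _ _ _ _ T0 fC1 _ Fd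
  sigmaC1 sigma_gt0 _ _ _ [ue0 ue_derive] [d [d0 _ d_cont]].
have ue_cont : {within `[0, T], continuous ue} by rewrite -d0; exact: d_cont.
have f_lip := C1_locally_lipschitz fC1.
have sigma_lip := C1_locally_lipschitz sigmaC1.
have sigma_neq0 x : sigma x != 0 by rewrite gt_eqF.
have sigmaV_lip := C1_inv_locally_lipschitz sigmaC1 sigma_neq0.
have F_lip : locally_lipschitz F.
  apply: is_derive_locally_lipschitz Fd _ => x; apply: cvgN.
  have fd := C1_is_derive fC1 x.
  by apply: differentiable_continuous; apply/derivable1_diffP; exact: ex_derive.
pose z t : 'M[R]_M * R := (ue t, E1 h F (ue t)).
have [B B0 zB] := exact_bounded h F_lip T0 ue_cont.
have B1 : 0 <= B + 1 by rewrite addr_ge0.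
have [Lw [Lw0 _ flowL]] :=
  bounded_lipschitz_flow (M := M) h eps f_lip F_lip sigma_lip sigmaV_lip B1.
have [K K0 stepK] :=
  step_consistent (M := M) h eps kappa f_lip F_lip sigma_lip sigmaV_lip B1.
have [K' K'0 zK] := exact_consistent f_lip Fd F_lip sigma_lip sigma_neq0 sigmaV_lip
  T0 ue_cont ue_derive.
have [tau0 [C [tau0_gt0 C_gt0 err]]] := one_step_convergence Lw0 K0 K'0 (ltW T0)
  zB flowL stepK zK.
(* |h| M converts the maximum norm of the error in u into [norm2], and 1 accounts for the error in
   s. *)
exists tau0, ((`|h| * M%:R + 1) * C); split=> //.
  by rewrite mulr_gt0 // ltr_wpDl ?mulr_ge0.
move=> tau tau_gt0 tau_le n nT; cbv zeta.
set us := gsav_ei1 _ _ _ _ _ _ _ _ n; set tn := n%:R * tau.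
have tnT : tn <= T.
  rewrite -ler_pdivlMr //; apply: le_trans (floor_le (T / tau)).
  by rewrite -[n%:R]/(n%:Z%:~R) ler_int.
have := err tau tau_gt0 tau_le n tnT.
rewrite /= ue0 -/tn -/(gsav_ei1 h f F sigma eps kappa tau uinit n) -/us.
rewrite prod_normE /= ge_max => /andP[u_le s_le].
by rewrite -mulrA mulrDl mul1r lerD // (le_trans (norm2_le _ _)) // ler_wpM2l //.
Qed.
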